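(* Let $(\mathcal{A}^V,X,\Phi)$ be the symbolic dynamical system defined in the context, with $V=V_\Box\sqcup V_\circ$ and network $(V,\to)$. (a) $\Phi$ has quadratic propagation at every $v\in V_\Box$; that is, $\liminf_{t\to\infty}\rho_v(t)/t^2>0$ for every $v\in V_\Box$. (b) $\dim_v(V,\to)=2$ for all $v\in V$.
   Context: Let $\mathcal{A}:=\mathbb{Z}/2\times\mathbb{Z}/2$. For $k\ge 0$ let $m_k:=\sum_{i=0}^k 2i=k(k+1)$ and $M:=\{m_k: k\ge 0\}=\{0,2,6,12,20,\dots\}$. The vertex set $V$ is indexed by $\mathbb{N}=\{0,1,2,\dots\}$: the vertex with index $n$ is denoted $\Box_n$ and belongs to $V_\Box$ if $n\in M$, and is denoted $\bigcirc_n$ and belongs to $V_\circ$ if $n\notin M$. The state of the vertex with index $n$ is a pair $(a_n,b_n)\in\mathbb{Z}/2\times\mathbb{Z}/2$. Let $X:=\{(a_n,b_n)_{n\in\mathbb{N}}\in\mathcal{A}^V : b_n=0\text{ for all } n\notin M\}$. The map $\Phi:\mathcal{A}^V\to\mathcal{A}^V$ is defined as follows, where $(a'_n,b'_n)_n=\Phi((a_n,b_n)_n)$: - for $n\notin M$: $(a'_n,b'_n)=(a_{n+1},0)$; - for $n=m_k\in M$: $(a'_{m_k},b'_{m_k})=(a_{m_k+1},\ a_{m_{k+1}}+b_{m_{k+1}})$. Then $\Phi$ is continuous and $\Phi(X)\subseteq X$. For a continuous map $\Psi:\mathcal{A}^V\to\mathcal{A}^V$ and $w\in V$, the input neighbourhood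 $\Psi_{\mathrm{in}}(w)$ is the (finite) set of $v\in V$ on which $\Psi(\cdot)_w$ depends nontrivially, i.e. there are $a,a'\in\mathcal{A}^V$ differing only at $v$ with $\Psi(a)_w\neq\Psi(a')_w$. The network of $\Phi$ is the digraph on $V$ with $v\to w$ iff $v\in\Phi_{\mathrm{in}}(w)$. (Thus the only edges are from index $n+1$ to index $n$ for every $n$, and from $\Box_{m_{k+1}}$ to $\Box_{m_k}$ for every $k$.) Propagation: $\rho_v(T):=\left|\bigcup_{t=0}^T(\Phi^t)_{\mathrm{in}}(v)\right|$. Balls: for $U\subseteq V$, $B(U,1):=U\cup\{v\in V:\exists u\in U,\ v\to u\}$ and $B(U,n+1):=B(B(U,n),1)$; $B(v,r):=B(\{v\},r)$. Connectivity dimension: $\dim_v(V,\to):=\lim_{r\to\infty}\frac{\log|B(v,r)|}{\log r}$ (the assertion includes that the limit exists). *)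

(* Defs.v *)
From HB Require Import structures.
From mathcomp Require Import all_boot all_order all_algebra.
From mathcomp Require Import finmap.
From mathcomp Require Import all_classical all_reals all_analysis.

Set Implicit Arguments.
Unset Strict Implicit.
Unset Printing Implicit Defensive.

Import Order.TTheory GRing.Theory Num.Theory.
Import numFieldNormedType.Exports.

Local Open Scope classical_set_scope.
Local Open Scope ring_scope.

(* A^V with the product topology, A being discrete. *)
Notation config A V := {ptws V -> discrete_topology A}.

Record symbolic_system (A : choiceType) (V : Type) := SymbolicSystem {
  subspace_of : set (config A V);
  evolution :> config A V -> config A V;
  evolution_continuous : continuous evolution;
  evolution_invariant : evolution @` subspace_of `<=` subspace_of }.

Definition input_nbhd (A : choiceType) (V : Type)
    (Psi : config A V -> config A V) (w : V) : set V :=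
  [set v | exists a b : config A V,
     (forall u, u <> v -> a u = b u) /\ Psi a w <> Psi b w].

Definition network (A : choiceType) (V : Type)
    (Psi : config A V -> config A V) (v w : V) : Prop := input_nbhd Psi w v.

(* [fset_set] is the finite set underlying a finite classical set (and is empty
   on infinite ones); see [finite_inputs] and [finite_network_ball]. *)
Definition propagation (A V : choiceType)
    (Psi : config A V -> config A V) (v : V) (T : nat) : nat :=
  #|` fset_set (\bigcup_(t in [set t | (t <= T)%N]) input_nbhd (iter t Psi) v) |.

(* The lower limit is taken in the extended reals, where it always exists. *)
Definition quadratic_propagation (R : realType) (A V : choiceType)
    (Psi : config A V -> config A V) (v : V) : Prop :=
  (0 < limn_einf (fun t : nat =>
          ((propagation Psi v t)%:R / t%:R ^+ 2 : R)%:E))%E.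

Definition in_closure (V : Type) (E : V -> V -> Prop) (U : set V) : set V :=
  U `|` [set v | exists2 u, U u & E v u].

Definition network_ball (V : Type) (E : V -> V -> Prop) (v : V) (r : nat) :
  set V := iter r (in_closure E) [set v].

Definition has_connectivity_dimension (R : realType) (V : choiceType)
    (E : V -> V -> Prop) (v : V) (d : R) : Prop :=
  (fun r : nat => ln (#|` fset_set (network_ball E v r) |%:R : R) / ln (r%:R : R))
    @ \oo --> d.

Definition mk (k : nat) : nat := (\sum_(0 <= i < k.+1) 2 * i)%N.

Definition V_box : set nat := range mk.
Definition V_circ : set nat := ~` V_box.

Definition state : choiceType := ('Z_2 * 'Z_2)%type.

Definition X_box : set (config state nat) :=
  [set x | forall n, V_circ n -> (x n).2 = 0].

(* The search for the [k] with [mk k = n] is bounded by [n] since [k <= mk k];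
   see [Phi_box] and [Phi_circ]. *)
Definition Phi (x : config state nat) : config state nat := fun n =>
  if [pick k : 'I_n.+1 | mk k == n] is Some k
  then ((x n.+1).1, (x (mk k.+1)).1 + (x (mk k.+1)).2)
  else ((x n.+1).1, 0).

Lemma mkE k : mk k = (k * k.+1)%N.
Proof.
rewrite /mk; elim: k => [|k IH]; first by rewrite big_nat1 muln0.
by rewrite big_nat_recr //= IH -mulnDl addn2 mulnC.
Qed.

Lemma leq_mk k : (k <= mk k)%N.
Proof. by rewrite mkE leq_pmulr. Qed.

Lemma leq_mk2 i j : (i <= j)%N -> (mk i <= mk j)%N.
Proof. by move=> ij; rewrite !mkE leq_mul. Qed.

Lemma mk_inj : injective mk.
Proof.
move=> i j; case: (ltngtP i j) => // lt; rewrite !mkE => e;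
  by have := ltn_mul lt (lt : (_.+1 < _.+1)%N); rewrite e ltnn.
Qed.

Lemma Phi_box x k :
  Phi x (mk k) = ((x (mk k).+1).1, (x (mk k.+1)).1 + (x (mk k.+1)).2).
Proof.
rewrite /Phi; case: pickP => [j /eqP/mk_inj ->//|].
have kk : (k < (mk k).+1)%N by rewrite ltnS leq_mk.
by move=> /(_ (Ordinal kk)); rewrite eqxx.
Qed.

Lemma Phi_circ x n : V_circ n -> Phi x n = ((x n.+1).1, 0).
Proof.
by rewrite /Phi; case: pickP => // j /eqP jn []; exists j.
Qed.

Lemma locally_constant_continuous (V W : Type) (K L : topologicalType)
    (f : {ptws V -> K} -> {ptws W -> L}) :
  (forall a w, \forall x \near a, f x w = f a w) -> continuous f.
Proof.
move=> H a; apply/cvg_sup; first exact/fmap_filter/nbhs_filter.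
move=> w U [_ [[B oB <-] Ba]] sU.
by have := H a w; apply: filterS => x e; apply: sU; rewrite /= e.
Qed.

Lemma near_coord (A : choiceType) (V : eqType) (a : config A V) (v : V) :
  \forall x \near a, x v = a v.
Proof.
exact: (@proj_continuous V (fun=> discrete_topology A) v a _
         (discrete_set1 (a v))).
Qed.

Lemma Phi_continuous : continuous Phi.
Proof.
apply: locally_constant_continuous => a w; rewrite /Phi.
have Fa := nbhs_filter a.
case: pickP => [k _|_].
  by apply: filterS2 (near_coord a w.+1) (near_coord a (mk k.+1)) => x -> ->.
by apply: filterS (near_coord a w.+1) => x ->.
Qed.

Lemma Phi_invariant : Phi @` X_box `<=` X_box.
Proof. by move=> _ [x _ <-] n /Phi_circ ->. Qed.

Definition box_system : symbolic_system state nat :=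
  SymbolicSystem Phi_continuous Phi_invariant.

Lemma Phi_local n (x y : config state nat) :
  (forall u, (u <= mk n.+1)%N -> x u = y u) ->
  forall u, (u <= n)%N -> Phi x u = Phi y u.
Proof.
move=> xy u un; rewrite /Phi xy; last exact: leq_trans (leq_mk n.+1).
case: pickP => // k _; rewrite xy// leq_mk2// ltnS.
by apply: leq_trans un; rewrite -ltnS.
Qed.

Lemma iter_Phi_local t n : exists N, forall x y : config state nat,
  (forall u, (u <= N)%N -> x u = y u) ->
  forall u, (u <= n)%N -> iter t Phi x u = iter t Phi y u.
Proof.
elim: t n => [|t IH] n; first by exists n.
have [N HN] := IH (mk n.+1); exists N => x y xy u un.
by apply: Phi_local un => w wn; apply: HN wn.
Qed.

Lemma finite_inputs t v : finite_set (input_nbhd (iter t Phi) v).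
Proof.
have [N HN] := iter_Phi_local t v.
apply: sub_finite_set (finite_II N.+1) => u [a [b [ab]]] /=.
apply: contra_notT; rewrite -leqNgt => Nu; apply: (HN a b) => // w wN.
by apply: ab => wu; move: Nu; rewrite -wu ltnNge wN.
Qed.

Lemma finite_network_ball v r :
  finite_set (network_ball (network box_system) v r).
Proof.
elim: r => [|r IH]; first exact: finite_set1.
rewrite /network_ball iterS; set U := iter r _ _.
have -> : in_closure (network box_system) U =
    U `|` \bigcup_(u in U) input_nbhd (iter 1 Phi) u by [].
by rewrite finite_setU; split => //; apply: bigcup_finite => // u _;
  exact: finite_inputs.
Qed.

(* Main.v *)
(* Unfolding the recursion for [b] gives
     b_t(m_k) = \sum_(1 <= j <= t) a_0(m_(k+j) + t - j) + b_0(m_(k+t)),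
   whose indices are pairwise distinct, so Phi^t at m_k reads every
   m_(k+j) + s with j + s = t and j >= 1.  Walking backwards in the network,
   j box edges and s unit edges lead from m_k to the same vertices.  Consecutive
   boxes m_i, m_(i+1) are only 2(i+1) apart, so for j up to about r/4 and
   j + s <= r these vertices fill a whole interval of length of order r^2.
   Conversely one backward step from [0, m_i] stays within [0, m_(i+1)], so
   balls grow at most quadratically. *)

Require Import Defs.
From HB Require Import structures.
From mathcomp Require Import all_boot all_order all_algebra.
From mathcomp Require Import finmap zify lra.
From mathcomp Require Import all_classical all_reals all_analysis.

Import Order.TTheory GRing.Theory Num.Theory.
Import numFieldNormedType.Exports.

Local Open Scope classical_set_scope.
Local Open Scope ring_scope.

Lemma limn_einf_ge (R : realType) (u : (\bar R)^nat) (c : \bar R) :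
  (\forall n \near \oo, (c <= u n)%E) -> (c <= limn_einf u)%E.
Proof.
move=> [N _ cu]; rewrite limn_einf_lim; apply: lime_ge; first exact: is_cvg_einfs.
exists N => // n /= Nn; apply: le_ereal_inf_tmp => _ [m nm <-].
exact: cu (leq_trans Nn nm).
Qed.

(** Taking logarithms, [ln (N r)] and [d * ln r] differ by at most [ln C], which becomes negligible
    after division by [ln r]. *)
Lemma ln_ratio_cvg (R : realType) (N : nat -> nat) (C d : nat) :
  (\forall r \near \oo, (r ^ d <= C * N r)%N /\ (N r <= C * r ^ d)%N) ->
  (fun r => ln (N r)%:R / ln r%:R : R) @ \oo --> (d%:R : R).
Proof.
move=> NC; apply/cvgrPdist_le => e e0; near=> r.
have [lo up] : (r ^ d <= C * N r)%N /\ (N r <= C * r ^ d)%N by near: r.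
have r1 : (1 < r)%N by near: r; exact: nbhs_infty_ge.
have lnr : 0 < ln r%:R :> R by rewrite ln_gt0 ?ltr1n.
have lnCr : ln C%:R / e <= ln r%:R :> R.
  rewrite -ler_expR lnK ?posrE ?ltr0n//; last exact: ltnW.
  by near: r; exact: nbhs_infty_ger.
have rd : (0 < r ^ d)%N by rewrite expn_gt0 (ltnW r1).
have [C0 N0] : (0 < C)%N /\ (0 < N r)%N.
  by apply/andP; rewrite -muln_gt0; exact: leq_trans lo.
have lnX : ln (r ^ d)%:R = d%:R * ln r%:R :> R.
  by rewrite natrX lnXn ?mulr_natl// ltr0n ltnW.
have lnlo : d%:R * ln r%:R <= ln C%:R + ln (N r)%:R :> R.
  rewrite -lnX -lnM ?posrE ?ltr0n// -natrM.
  by rewrite ler_ln ?posrE ?ltr0n ?ler_nat ?muln_gt0 ?C0.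
have lnup : ln (N r)%:R <= ln C%:R + d%:R * ln r%:R :> R.
  rewrite -lnX -lnM ?posrE ?ltr0n// -natrM.
  by rewrite ler_ln ?posrE ?ltr0n ?ler_nat ?muln_gt0 ?C0.
rewrite ler_pdivrMr// in lnCr.
rewrite -[d%:R](mulfK (lt0r_neq0 lnr)) -mulrBl normrM normfV (gtr0_norm lnr).
by rewrite ler_pdivrMr// ler_norml; apply/andP; split; lra.
Unshelve. all: by end_near. Qed.

Lemma mkS k : mk k.+1 = (mk k + k.+1.*2)%N.
Proof. rewrite !mkE; lia. Qed.

Lemma mk_cover k q i : (mk k <= i < mk (k + q))%N ->
  exists2 j, (j < q)%N & exists2 s, (s < (k + j).+1.*2)%N & i = (mk (k + j) + s)%N.
Proof.
elim: q => [|q IH]; first by rewrite addn0; lia.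
move=> /andP[ki]; rewrite addnS mkS => iq.
have [iq'|qi] := ltnP i (mk (k + q)).
  by have [|j jq H] := IH _; [rewrite ki|exists j => //; exact: ltnW].
by exists q => //; exists (i - mk (k + q))%N; lia.
Qed.

(** Serves both lower bounds: [A] is a set of inputs or a ball, and [c] is the time spent before the
    box count [j] starts. *)
Lemma card_mk_triangle (A : set nat) (k c r : nat) :
  finite_set A ->
  (forall j s, (c + j + s <= r)%N -> A (mk (k + j) + s)%N) ->
  (4 * (c + 2 * k).+1 <= r)%N -> (r ^ 2 <= 64 * #|` fset_set A |)%N.
Proof.
move=> finA HA kr; pose J := (r %/ 4)%N.
have JA : (mk (k + J) - mk k <= #|` fset_set A |)%N.
  apply: leq_card_fset_set => //; rewrite -(card_le_eql card_IID).
  apply: subset_card_le => i [/= iJ /negP]; rewrite -leqNgt => ki.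
  have [|j jJ [s sj ->]] := @mk_cover k J i; first by rewrite ki.
  (* Since [s <= 2 * (k + j) + 1], the cost [c + j + s] is at most [(c + 2 * k + 1) + 3 * j], hence
     at most [J + 3 * J <= r]. *)
  by apply: HA; rewrite /J in jJ; lia.
(* The interval has at least [J ^ 2] points, and [r < 4 * (J + 1) <= 8 * J] as [J >= 1]; hence the
   constant 64. *)
apply: leq_trans (leq_mul (leqnn 64) JA); rewrite !mkE /J.
have := divn_eq r 4; have := ltn_pmod r (isT : 0 < 4)%N.
nia.
Qed.

Lemma Phi_fst (x : config state nat) n : (Phi x n).1 = (x n.+1).1.
Proof. by rewrite /Phi; case: pickP. Qed.

Lemma iter_Phi_fst t (x : config state nat) n :
  (iter t Phi x n).1 = (x (n + t)%N).1.
Proof.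
by elim: t n => [|t IH] n; rewrite ?addn0// iterS Phi_fst IH addSnnS.
Qed.

Lemma iter_Phi_box_snd t (x : config state nat) k :
  (iter t Phi x (mk k)).2 =
  \sum_(j < t) (x (mk (k + j.+1) + (t - j.+1))%N).1 + (x (mk (k + t))).2.
Proof.
elim: t k => [|t IH] k; first by rewrite big_ord0 add0r addn0.
rewrite iterS Phi_box /= iter_Phi_fst IH big_ord_recl /= subn1 addn1.
rewrite addrA addSnnS; congr (_ + _ + _); apply: eq_bigr => j _.
by rewrite addSnnS subSS.
Qed.

Definition pulse (a : state) (u : nat) : config state nat :=
  fun n => if n == u then a else 0.

Lemma pulse_off a u n : n <> u -> pulse 0 u n = pulse a u n.
Proof. by rewrite /pulse => /eqP/negbTE ->. Qed.

Lemma Phi_edge_succ n : network box_system n.+1 n.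
Proof.
exists (pulse 0 n.+1), (pulse (1, 0) n.+1); split; first exact: pulse_off.
by move=> /(congr1 fst); rewrite /= !Phi_fst /pulse eqxx.
Qed.

Lemma Phi_edge_box k : network box_system (mk k.+1) (mk k).
Proof.
exists (pulse 0 (mk k.+1)), (pulse (0, 1) (mk k.+1)).
split; first exact: pulse_off.
by move=> /(congr1 snd); rewrite /= !Phi_box /pulse eqxx.
Qed.

Lemma Phi_edge_bound u n k :
  network box_system u n -> (n <= mk k)%N -> (u <= mk k.+1)%N.
Proof.
move=> [a [b [ab neq]]] nk; rewrite leqNgt; apply/negP => ku; apply: neq.
have abk w : (w <= mk k.+1)%N -> a w = b w.
  by move=> wk; apply: ab => wu; rewrite wu leqNgt ku in wk.
have nS : (n < mk k.+1)%N by rewrite mkS; lia.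
case: (pselect (V_box n)) => [[j _ jn]|Vn]; last by rewrite /= !Phi_circ// abk.
rewrite -jn /= !Phi_box !abk ?jn//; apply: leq_mk2.
(* By monotonicity of [mk], [mk j <= mk k] forces [j <= k]. *)
by move: nk; rewrite -jn !mkE ltnS; nia.
Qed.

Lemma input_nbhd_iter_Phi k j s :
  input_nbhd (iter (j.+1 + s) Phi) (mk k) (mk (k + j.+1) + s)%N.
Proof.
set u := (mk (k + j.+1) + s)%N.
exists (pulse 0 u), (pulse (1, 0) u); split; first exact: pulse_off.
move=> /(congr1 snd); rewrite !iter_Phi_box_snd.
have pulse0 n : pulse 0 u n = 0 by rewrite /pulse if_same.
rewrite pulse0 big1 => [|i _]; last by rewrite pulse0.
have ->: (pulse (1, 0) u (mk (k + (j.+1 + s)))).2 = 0.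
  by rewrite /pulse; case: eqP.
have jlt : (j < j.+1 + s)%N by lia.
rewrite (bigD1 (Ordinal jlt)) //= addKn /pulse eqxx big1 ?addr0//= => i ij.
case: eqP => // e; move: ij; rewrite -val_eqE /= => /eqP[].
(* The index read by the [i]-th summand strictly increases with [i]: [mk] grows by more than 1 while
   the shift drops by 1. So only [i = j] reads [u]. *)
by move: e; rewrite /u !mkE; have := ltn_ord i; nia.
Qed.

Lemma network_ball_le v p r :
  (v <= mk p)%N -> network_ball (network box_system) v r `<=` `I_(mk (p + r)).+1.
Proof.
move=> vp; elim: r => [u ->|r IH u]; first by rewrite /= addn0 ltnS.
rewrite /network_ball iterS => -[/IH|[w /IH]] /=; rewrite !ltnS addnS.
  by move=> /leq_trans; apply; apply: leq_mk2.
by move=> wr /Phi_edge_bound; apply.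
Qed.

Lemma network_ball_trans (V : Type) (E : V -> V -> Prop) u v w r r' :
  network_ball E v r u -> network_ball E u r' w -> network_ball E v (r + r')%N w.
Proof.
move=> vu; elim: r' w => [w ->|r' IH w]; first by rewrite addn0.
rewrite /network_ball addnS !iterS => -[/IH|[x /IH]] H; first by left.
by move=> wx; right; exists x.
Qed.

Lemma network_ball_addn v s r : (s <= r)%N ->
  network_ball (network box_system) v r (v + s)%N.
Proof.
elim: r s => [|r IH] s; first by rewrite leqn0 => /eqP ->; rewrite addn0.
rewrite /network_ball iterS; case: s => [_|s sr].
  by left; exact: IH.
by right; exists (v + s)%N; [exact: IH|rewrite addnS; exact: Phi_edge_succ].
Qed.

Lemma network_ball_box k j :
  network_ball (network box_system) (mk k) j (mk (k + j)).
Proof.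
elim: j => [|j IH]; first by rewrite addn0.
rewrite /network_ball iterS; right; exists (mk (k + j)) => //.
by rewrite addnS; exact: Phi_edge_box.
Qed.

(** As [v] need not be a box, unit edges first lead up to the box [mk v]; then come [j] box edges
    and [s] unit edges. *)
Lemma network_ball_triangle v r j s : (mk v - v + j + s <= r)%N ->
  network_ball (network box_system) v r (mk (v + j) + s)%N.
Proof.
move=> h; have -> : r = (mk v - v + j + (r - (mk v - v + j)))%N by lia.
apply: (@network_ball_trans _ _ (mk (v + j))); last first.
  by apply: network_ball_addn; lia.
apply: (@network_ball_trans _ _ (mk v)); last exact: network_ball_box.
by rewrite -{2}(subnKC (leq_mk v)); exact: network_ball_addn.
Qed.

Theorem lemma4p2 (R : realType) :
  (forall v : nat, V_box v -> quadratic_propagation R box_system v) /\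
  (forall v : nat, has_connectivity_dimension (network box_system) v (2 : R)).
Proof.
split=> [_ [k _ <-]|v].
  apply: (@lt_le_trans _ _ (64%:R^-1)%:E); first by rewrite lte_fin invr_gt0.
  apply: limn_einf_ge; near=> T.
  have T0 : (0 < T)%N by near: T; exact: nbhs_infty_ge.
  rewrite lee_fin ler_pdivlMr ?exprn_gt0 ?ltr0n// mulrC ler_pdivrMr//.
  rewrite -natrX -natrM ler_nat mulnC.
  (* Inputs require at least one box step, so the triangle starts at [k.+1] with one time unit
     already spent. *)
  apply: (@card_mk_triangle _ k.+1 1).
  - apply: bigcup_finite => [|t _]; last exact: finite_inputs.
    by apply: sub_finite_set (finite_II T.+1) => t.
  - move=> j s jsT; exists (j.+1 + s)%N; first by rewrite /= -add1n.
    by rewrite (addSnnS k j); exact: input_nbhd_iter_Phi.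
  - by near: T; exact: nbhs_infty_ge.
apply: (@ln_ratio_cvg _ _ 64 2); near=> r; split.
  apply: (@card_mk_triangle _ v (mk v - v)); first exact: finite_network_ball.
    by move=> j s; exact: network_ball_triangle.
  by near: r; exact: nbhs_infty_ge.
apply: (@leq_trans (mk (v + r)).+1).
  apply: geq_card_fset_set; apply: subset_card_le.
  by apply: network_ball_le; exact: leq_mk.
have vr : (v < r)%N by near: r; exact: nbhs_infty_ge.
(* For [v < r], [mk (v + r) + 1 <= (2 * r - 1) * (2 * r) + 1 <= 4 * r ^ 2], well below the bound. *)
by rewrite mkE; nia.
Unshelve. all: by end_near. Qed.
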